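(* Let $\mathbf{d}$ be a linear continuous dilation in $\mathbb{R}^n$ that is monotone with respect to a norm $\|\cdot\|$ in $\mathbb{R}^n$. Let $\Omega\subset\mathbb{R}^n$ be a closed $\mathbf{d}$-homogeneous cone, and let $g\in C(\mathbb{R}^n)$ be a $\mathbf{d}$-homogeneous vector field of degree $\mu\in\mathbb{R}$ such that $g(0)=0$ and solutions of the system $\dot x=g(x)$, $t>0$, $x(0)=x_0$, are forward unique and complete on $\Omega$. Then $\Omega$ is positively invariant for the system $\dot x=g(x)$ if and only if $$g(x)\in\mathcal{C}_\Omega(x),\quad\forall x\in\partial\Omega\cap S,$$ where $S=\{x\in\mathbb{R}^n:\|x\|=1\}$ is the unit sphere.
   Context: A linear continuous dilation in $\mathbb{R}^n$ is a family $\mathbf{d}(s)=e^{sG_{\mathbf{d}}}$, $s\in\mathbb{R}$, with generator $G_{\mathbf{d}}\in\mathbb{R}^{n\times n}$, such that $\liminf_{s\to+\infty}\|\mathbf{d}(s)x\|=+\infty$ and $\limsup_{s\to-\infty}\|\mathbf{d}(s)x\|=0$ for all $x\ne 0$. It is monotone with respect to $\|\cdot\|$ if $s\mapsto\|\mathbf{d}(s)x\|$ is strictly increasing for each $x\neq 0$. A nonempty set $\Omega\subset\mathbb{R}^n$ is a $\mathbf{d}$-homogeneous cone if $\mathbf{d}(s)\Omega\subset\Omega$ for all $s\in\mathbb{R}$. A vector field $g:\mathbb{R}^n\to\mathbb{R}^n$ is $\mathbf{d}$-homogeneous of degree $\mu$ if $g(\mathbf{d}(s)x)=e^{\mu s}\mathbf{d}(s)g(x)$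 for all $x\in\mathbb{R}^n,s\in\mathbb{R}$. The (Bouligand) tangent cone to $\Omega$ at $x\in\Omega$ is $\mathcal{C}_\Omega(x)=\{z\in\mathbb{R}^n:\liminf_{h\to0^+}\frac{1}{h}\inf_{y\in\Omega}\|x+hz-y\|=0\}$. Forward unique and complete on $\Omega$: for every initial state $x_0\in\Omega$ the solution is unique in forward time and defined for all $t\ge0$. The closed set $\Omega$ is positively invariant if, for any solution, $x(t^* )\in\Omega$ implies $x(t)\in\Omega$ for all $t>t^*$. *)

(* Defs.v *)
From mathcomp Require Export all_boot all_order all_algebra.
From mathcomp Require Export all_classical all_reals all_analysis.
Export Order.TTheory GRing.Theory Num.Theory.
Export numFieldNormedType.Exports.

#[export] Set Implicit Arguments.
#[export] Unset Strict Implicit.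
#[export] Unset Printing Implicit Defensive.

#[global] Open Scope classical_set_scope.
#[global] Open Scope ring_scope.

(* All topological notions on 'cV[R]_n and 'M[R]_n (closed, continuous, lim,
   derivatives) refer to the max-norm instance, whose topology is the usual
   Euclidean one. The norm of the problem is a separate argument nrm; every
   quantitative notion below is stated with it. *)

Record is_norm (R : realType) (n : nat) (nrm : 'cV[R]_n -> R) : Prop := IsNorm {
  is_norm_eq0 : forall x, nrm x = 0 -> x = 0;
  is_normZ : forall (a : R) x, nrm (a *: x) = `|a| * nrm x;
  is_norm_triangle : forall x y, nrm (x + y) <= nrm x + nrm y
}.

Definition expmx (R : realType) (n : nat) (A : 'M[R]_n) : 'M[R]_n :=
  lim (series (fun k : nat => (k`!%:R)^-1 *: A ^+ k) @ \oo).

(* G is the generator of the dilation. *)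
Definition is_dilation (R : realType) (n : nat) (nrm : 'cV[R]_n -> R)
    (d : R -> 'M[R]_n) : Prop :=
  [/\ exists G : 'M[R]_n, forall s, d s = expmx (s *: G),
      forall x : 'cV[R]_n, x != 0 ->
        limf_einf (fun s : R => (nrm (d s *m x))%:E) (pinfty_nbhs R) = +oo%E
    & forall x : 'cV[R]_n, x != 0 ->
        limf_esup (fun s : R => (nrm (d s *m x))%:E) (ninfty_nbhs R) = 0%E].

Definition monotone_dilation (R : realType) (n : nat) (nrm : 'cV[R]_n -> R)
    (d : R -> 'M[R]_n) : Prop :=
  forall x : 'cV[R]_n, x != 0 ->
    {homo (fun s : R => nrm (d s *m x)) : s t / s < t}.

Definition homogeneous_cone (R : realType) (n : nat) (d : R -> 'M[R]_n)
    (Omega : set 'cV[R]_n) : Prop :=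
  Omega !=set0 /\ forall s : R, mulmx (d s) @` Omega `<=` Omega.

Definition homogeneous_field (R : realType) (n : nat) (d : R -> 'M[R]_n)
    (mu : R) (g : 'cV[R]_n -> 'cV[R]_n) : Prop :=
  forall (x : 'cV[R]_n) (s : R), g (d s *m x) = expR (mu * s) *: (d s *m g x).

Definition tangent_cone (R : realType) (n : nat) (nrm : 'cV[R]_n -> R)
    (Omega : set 'cV[R]_n) (x : 'cV[R]_n) : set 'cV[R]_n :=
  [set z | limf_einf
    (fun h : R => (h^-1 * inf [set nrm (x + h *: z - y) | y in Omega])%:E)
    (0^'+) = 0%E].

Definition boundary (T : topologicalType) (A : set T) : set T :=
  closure A `\` A°.

Definition unit_sphere (R : realType) (n : nat) (nrm : 'cV[R]_n -> R) :
  set 'cV[R]_n := [set x | nrm x = 1].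

(* u solves u' = g u on [0, T[, where T may be +oo; the values of u outside
   [0, T[ are irrelevant. *)
Definition is_solution (R : realType) (n : nat) (g : 'cV[R]_n -> 'cV[R]_n)
    (T : \bar R) (u : R -> 'cV[R]_n) : Prop :=
  [/\ (0 < T)%E,
      {within [set t : R | 0 <= t /\ (t%:E < T)%E], continuous u}
    & forall t : R, 0 < t -> (t%:E < T)%E -> is_derive t 1 u (g (u t))].

(* Uniqueness is required of all solutions issued from Omega, including those
   given only on a bounded interval [0, T[. *)
Definition forward_unique_on (R : realType) (n : nat)
    (g : 'cV[R]_n -> 'cV[R]_n) (Omega : set 'cV[R]_n) : Prop :=
  forall x0, Omega x0 -> forall (T : \bar R) (u v : R -> 'cV[R]_n),
    is_solution g T u -> u 0 = x0 -> is_solution g T v -> v 0 = x0 ->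
    forall t : R, 0 <= t -> (t%:E < T)%E -> u t = v t.

Definition forward_complete_on (R : realType) (n : nat)
    (g : 'cV[R]_n -> 'cV[R]_n) (Omega : set 'cV[R]_n) : Prop :=
  forall x0, Omega x0 ->
    exists u : R -> 'cV[R]_n, is_solution g +oo%E u /\ u 0 = x0.

(* The solution may start outside Omega and need not be global. *)
Definition positively_invariant (R : realType) (n : nat)
    (g : 'cV[R]_n -> 'cV[R]_n) (Omega : set 'cV[R]_n) : Prop :=
  forall (T : \bar R) (u : R -> 'cV[R]_n), is_solution g T u ->
  forall t' : R, 0 <= t' -> (t'%:E < T)%E -> Omega (u t') ->
  forall t : R, t' < t -> (t%:E < T)%E -> Omega (u t).

(* Main.v *)
Require Import Defs.
From mathcomp Require Import ring lra.

(** The statement is a homogeneous form of Nagumo's invariance theorem.  Call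
    a vector [z] subtangent to [Omega] at [x] if [x + h z] comes within [o(h)]
    of [Omega] along some sequence [h -> 0+].  By equivalence of norms, this is
    membership of [z] in the tangent cone, whatever norm measures the distance
    ([tangent_coneP]).

    Homogeneity carries subtangency from the sphere to all of [Omega].  Every
    orbit [s |-> d s x] of a point [x != 0] meets the unit sphere, by the
    intermediate value theorem, and the linear bijection [d s] maps [Omega]
    onto itself and the direction [g x] to a positive multiple of [g (d s x)].
    At interior points and at the origin, where [g] vanishes, subtangency is
    free ([subtangent_everywhere]).

    If [Omega] is invariant, the solution issued from [x] stays in [Omega] and
    leaves [x] with velocity [g x], which is therefore subtangent
    ([invariant_subtangent]).

    Conversely, subtangency at every point of [Omega] provides approximate
    Euler polygons with nodes in [Omega], of any accuracy
    ([approximate_solution]).  They stay in a fixed compact set, so they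
    converge pointwise along an ultrafilter of accuracies, and the drift
    estimates of the polygons pass to the limit, which is a solution with
    values in [Omega] ([local_viability]).  A solution that leaves [Omega] has
    a last time in [Omega]; from there, forward uniqueness makes it coincide
    for a while with the solution that remains in [Omega], a contradiction.  *)

(** * Matrices: entries and norms *)

Lemma mx_normr_entry (R : realType) (m n : nat) (A : 'M[R]_(m, n)) i j :
  `|A i j| <= `|A|.
Proof. by rewrite [leRHS]/Num.norm/= mx_normrE; exact: (le_bigmax _ _ (i, j)). Qed.

Lemma mx_normr_le (R : realType) (m n : nat) (A : 'M[R]_(m, n)) (e : R) :
  0 <= e -> (forall i j, `|A i j| <= e) -> `|A| <= e.
Proof.
by move=> e0 Ae; rewrite /Num.norm/= mx_normrE (bigmax_le _ e0).
Qed.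

Lemma cvg_mx_entries (R : realType) (m n : nat) (I : Type) (F : set_system I)
    {FF : Filter F} (f : I -> 'M[R]_(m, n)) (l : 'M[R]_(m, n)) :
  (forall i j, f x i j @[x --> F] --> l i j) -> f x @[x --> F] --> l.
Proof.
move=> fl; apply/cvgrPdist_le => e e0.
have : \forall x \near F, forall ij, `|l ij.1 ij.2 - f x ij.1 ij.2| <= e.
  apply: filter_forall => -[i j]; exact: ((cvgrPdist_le _ _).1 (fl i j)).
apply: filterS => x le_e; apply: mx_normr_le => [|i j]; first exact: ltW.
by rewrite !mxE; exact: (le_e (i, j)).
Qed.

Lemma mulmx_continuous (R : realType) (m n p : nat) (A : 'M[R]_(m, n)) :
  continuous (fun B : 'M[R]_(n, p) => A *m B).
Proof.
move=> B; apply: (@cvg_mx_entries _ _ _ _ (nbhs B)) => i j; rewrite mxE.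
under eq_fun do rewrite mxE.
apply: cvg_big => [|k _]; [exact: add_continuous|apply: cvgM]; first exact: cvg_cst.
exact: coord_continuous.
Qed.

Lemma mulmxr_continuous (R : realType) (m n p : nat) (A : 'M[R]_(n, p)) :
  continuous (fun B : 'M[R]_(m, n) => B *m A).
Proof.
move=> B; apply: (@cvg_mx_entries _ _ _ _ (nbhs B)) => i j; rewrite mxE.
under eq_fun do rewrite mxE.
apply: cvg_big => [|k _]; [exact: add_continuous|apply: cvgM]; last exact: cvg_cst.
exact: coord_continuous.
Qed.

(** Powers are taken in the ring of square matrices; these forms of their
    recursion expose the product of rectangular matrices. *)
Lemma mx_exprE (R : realType) (n : nat) (A : 'M[R]_n) k :
  (A ^+ k.+1 = A *m A ^+ k) * (A ^+ k.+1 = A ^+ k *m A).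
Proof. by rewrite {1}exprS exprSr. Qed.

Lemma mx_exprZ (R : realType) (n : nat) (A : 'M[R]_n) (s : R) k :
  (s *: A) ^+ k = s ^+ k *: A ^+ k.
Proof.
elim: k => [|k IH]; first by rewrite !expr0 scale1r.
by rewrite !(mx_exprE _ _).1 IH -scalemxAl -scalemxAr scalerA -exprS.
Qed.

Lemma mx_normrM (R : realType) (m n p : nat) (A : 'M[R]_(m, n))
    (B : 'M[R]_(n, p)) : `|A *m B| <= n%:R * `|A| * `|B|.
Proof.
apply: mx_normr_le => [|i j]; first by rewrite !mulr_ge0.
rewrite mxE (le_trans (ler_norm_sum _ _ _))//.
have -> : n%:R * `|A| * `|B| = \sum_(k < n) `|A| * `|B|.
  by rewrite sumr_const card_ord -mulrA mulr_natl.
by rewrite ler_sum// => l _; rewrite normrM ler_pM// mx_normr_entry.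
Qed.

Lemma mx_normrX (R : realType) (n : nat) (A : 'M[R]_n) k :
  `|A ^+ k| <= (n%:R * `|A|) ^+ k.
Proof.
elim: k => [|k IH].
  rewrite expr0; apply: mx_normr_le => // i j.
  by rewrite mxE; case: eqP => _; rewrite ?normr1 ?normr0.
rewrite (mx_exprE _ _).1 exprS (le_trans (mx_normrM _ _))//.
by rewrite ler_wpM2l// mulr_ge0.
Qed.

(** * The matrix exponential *)

(** The power series, in the scalar [s], of an entry of
    [A ^+ p *m expmx (s *: A)].  With the shift [p], the family is stable under
    formal differentiation, so that one convergence lemma covers all the
    derivatives. *)
Definition expmx_coeff (R : realType) (n : nat) (A : 'M[R]_n) p i j : R^nat :=
  fun k => (A ^+ (k + p)) i j / k`!%:R.

(** Domination by the exponential series at [n |A| |x|], the factor [n] coming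
    from the max-norm of a product. *)
Lemma is_cvg_expmx_coeff (R : realType) (n : nat) (A : 'M[R]_n) p i j x :
  cvgn (pseries (expmx_coeff A p i j) x).
Proof.
pose a := n%:R * `|A|.
have a0 : 0 <= a by rewrite mulr_ge0.
apply: normed_cvg.
apply: (@series_le_cvg _ _ (a ^+ p *: exp_coeff (a * `|x|))) => [k|k|k|].
- exact: normr_ge0.
- by rewrite mulr_ge0 ?exprn_ge0// /exp_coeff/= divr_ge0// exprn_ge0// mulr_ge0.
- have -> : (a ^+ p *: exp_coeff (a * `|x|)) k =
      a ^+ (k + p) * (`|x| ^+ k / k`!%:R).
    rewrite -[LHS]/(a ^+ p * ((a * `|x|) ^+ k / k`!%:R)).
    by rewrite exprD [(_ * `|x|) ^+ k]exprMn !mulrA [a ^+ p * _]mulrC.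
  rewrite /= /expmx_coeff !normrM normfV normr_nat normrX.
  rewrite -mulrA [_^-1 * _]mulrC ler_wpM2r ?divr_ge0 ?exprn_ge0//.
  exact: (le_trans (mx_normr_entry _ _ _) (mx_normrX _ _)).
- exact/is_cvg_seriesZ/is_cvg_series_exp_coeff.
Qed.

Lemma pseries_diffs_expmx_coeff (R : realType) (n : nat) (A : 'M[R]_n) p i j :
  pseries_diffs (expmx_coeff A p i j) = expmx_coeff A p.+1 i j.
Proof.
apply/funext => k; rewrite /pseries_diffs /expmx_coeff addSnnS factS natrM invfM.
by rewrite mulrCA mulVKf// pnatr_eq0.
Qed.

Lemma pseries_expmx_coeff (R : realType) (n : nat) (A : 'M[R]_n) p i j s N :
  pseries (expmx_coeff A p i j) s N =
  (A ^+ p *m series (fun k : nat => (k`!%:R)^-1 *: (s *: A) ^+ k) N) i j.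
Proof.
rewrite /pseries /series/= mulmx_sumr summxE; apply: eq_bigr => k _.
rewrite -scalemxAr mx_exprZ -scalemxAr -[_ *m _]/(A ^+ p * A ^+ k) -exprD.
by rewrite /expmx_coeff addnC mulrC [_ / _]mulrC mulrCA !mxE.
Qed.

Lemma expmx_cvg (R : realType) (n : nat) (A : 'M[R]_n) s :
  series (fun k : nat => (k`!%:R)^-1 *: (s *: A) ^+ k) @ \oo --> expmx (s *: A).
Proof.
apply/(cvgP (\matrix_(i, j) limn (pseries (expmx_coeff A 0 i j) s))).
apply: (@cvg_mx_entries _ _ _ _ \oo) => i j; rewrite mxE.
rewrite [X in X @ _ --> _](_ : _ = pseries (expmx_coeff A 0 i j) s).
  exact: is_cvg_expmx_coeff.
by apply/funext => N; rewrite pseries_expmx_coeff expr0 mul1mx.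
Qed.

Lemma lim_pseries_expmx_coeff (R : realType) (n : nat) (A : 'M[R]_n) p i j s :
  limn (pseries (expmx_coeff A p i j) s) = (A ^+ p *m expmx (s *: A)) i j.
Proof.
have H := cvg_comp _ _ (cvg_comp _ _ (@expmx_cvg _ _ A s)
  (@mulmx_continuous _ _ _ _ (A ^+ p) _)) (@coord_continuous _ _ _ i j _).
rewrite -(cvg_lim _ H)//; congr (lim (_ @ \oo)).
by apply/funext => N; rewrite pseries_expmx_coeff.
Qed.

Lemma expmx_comm (R : realType) (n : nat) (A : 'M[R]_n) s :
  A *m expmx (s *: A) = expmx (s *: A) *m A.
Proof.
have H1 := cvg_comp _ _ (@expmx_cvg _ _ A s) (@mulmx_continuous _ _ _ _ A _).
have H2 := cvg_comp _ _ (@expmx_cvg _ _ A s) (@mulmxr_continuous _ _ _ _ A _).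
rewrite -(cvg_lim _ H1)// -(cvg_lim _ H2)//; congr (lim (_ @ \oo)).
apply/funext => N /=; rewrite /series /= mulmx_sumr mulmx_suml.
apply: eq_bigr => k _.
by rewrite mx_exprZ -!scalemxAr -!scalemxAl -(mx_exprE _ _).1 (mx_exprE _ _).2.
Qed.

Lemma is_derive_expmx (R : realType) (n : nat) (A : 'M[R]_n) i j s :
  is_derive s (1 : R) (fun t => expmx (t *: A) i j) ((A *m expmx (s *: A)) i j).
Proof.
have sK : `|s| < `| `|s| + 1 | by rewrite [ltRHS]ger0_norm ?ltrDl// addr_ge0.
have := @pseries_snd_diffs R (expmx_coeff A 0 i j) (`|s| + 1) s.
rewrite !pseries_diffs_expmx_coeff => /(_ (@is_cvg_expmx_coeff _ _ _ _ _ _ _)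
  (@is_cvg_expmx_coeff _ _ _ _ _ _ _) (@is_cvg_expmx_coeff _ _ _ _ _ _ _) sK).
rewrite (lim_pseries_expmx_coeff A 1) expr1.
by under eq_fun do rewrite lim_pseries_expmx_coeff expr0 mul1mx.
Qed.

Lemma expmx_continuous (R : realType) (n : nat) (A : 'M[R]_n) :
  continuous (fun s : R => expmx (s *: A)).
Proof.
move=> s; apply: (@cvg_mx_entries _ _ _ _ (nbhs s)) => i j.
apply: differentiable_continuous; apply/derivable1_diffP.
exact: (@ex_derive _ _ _ _ _ _ _ (is_derive_expmx A i j s)).
Qed.

Lemma expmx0 (R : realType) (n : nat) : expmx (0 : 'M[R]_n) = 1%:M.
Proof.
apply: cvg_lim => //; apply: cvg_near_cst; exists 1%N => // -[//|N] _.
rewrite /series/= big_nat_recl// expr0 fact0 invr1 scale1r.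
rewrite big1 ?addr0// => k _.
by rewrite (mx_exprE _ _).1 mul0mx scaler0.
Qed.

(** The derivative of the product in [s] is the difference of two terms, both
    equal to [expmx (s A) A expmx (- s A)] because [A] commutes with its
    exponential; hence the product keeps its value at [s = 0]. *)
Lemma expmxN (R : realType) (n : nat) (A : 'M[R]_n) s :
  expmx (s *: A) *m expmx (- s *: A) = 1%:M.
Proof.
pose P t := expmx (t *: A) *m expmx (- t *: A).
suff H i j x y : P x i j = P y i j.
  transitivity (P 0); first by apply/matrixP => i j; exact: H.
  by rewrite /P oppr0 !scale0r expmx0 mul1mx.
apply: (is_derive_0_is_cst (f := fun t => P t i j)) => {}s.
pose e (t : R) k l := expmx (t *: A) k l.
have de t k l : is_derive t (1 : R) (fun u => e u k l) ((A *m expmx (t *: A)) k l).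
  exact: is_derive_expmx.
have dN k l : is_derive s (1 : R) (fun t => e (- t) k l)
    ((A *m expmx (- s *: A)) k l * (-1)).
  have dopp : is_derive s (1 : R) (fun t : R => - t) (- 1).
    exact: (is_deriveN (is_derive_id _ _)).
  exact: (@is_derive1_comp R (fun t => e t k l) _ s _ _ (de _ _ _) dopp).
pose h (k : 'I_n) : R -> R := (fun t => e t i k) * (fun t => e (- t) k j).
have dh k : is_derive s (1 : R) (h k)
    ((expmx (s *: A) i k) *: ((A *m expmx (- s *: A)) k j * (-1)) +
     (expmx (- s *: A) k j) *: (expmx (s *: A) *m A) i k).
  by rewrite -expmx_comm; exact: is_deriveM.
have -> : (fun t => P t i j) = \sum_(k < n) h k.
  by apply/funext => t; rewrite fct_sumE mxE.
apply: (is_derive_eq (is_derive_sum dh)).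
rewrite big_split/=.
under eq_bigr do rewrite mulrN1 scalerN.
rewrite sumrN addrC.
under eq_bigr do rewrite -[_ *: _]/(_ * _) mulrC.
have -> : \sum_i0 (expmx (s *: A) *m A) i i0 * expmx (- s *: A) i0 j =
  ((expmx (s *: A) *m A) *m expmx (- s *: A)) i j by rewrite [in RHS]mxE.
have -> : \sum_i0 expmx (s *: A) i i0 *: (A *m expmx (- s *: A)) i0 j =
  (expmx (s *: A) *m (A *m expmx (- s *: A))) i j by rewrite [in RHS]mxE.
by rewrite mulmxA subrr.
Qed.

(** * Norms and tangent cones *)

Lemma is_norm0 (R : realType) (n : nat) (nrm : 'cV[R]_n -> R) :
  is_norm nrm -> nrm 0 = 0.
Proof. by move=> N; rewrite -(scale0r 0) (is_normZ N) normr0 mul0r. Qed.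

Lemma is_norm_ge0 (R : realType) (n : nat) (nrm : 'cV[R]_n -> R) x :
  is_norm nrm -> 0 <= nrm x.
Proof.
move=> N; have := is_norm_triangle N x ((-1) *: x).
by rewrite (is_normZ N) scaleN1r subrr (is_norm0 N) normrN1; lra.
Qed.

Lemma is_norm_upper (R : realType) (n : nat) (nrm : 'cV[R]_n -> R) :
  is_norm nrm -> exists2 C, 0 < C & forall x, nrm x <= C * `|x|.
Proof.
move=> N; exists (1 + \sum_(i < n) nrm (delta_mx i 0)).
  by rewrite ltr_pwDl// sumr_ge0// => i _; exact: is_norm_ge0.
move=> x; rewrite mulrDl mul1r ler_wpDl// mulr_suml.
rewrite [in leLHS](matrix_sum_delta x).
under eq_bigr do rewrite big_ord1.
have S (r : seq 'I_n) (f : 'I_n -> 'cV[R]_n) :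
    nrm (\sum_(i <- r) f i) <= \sum_(i <- r) nrm (f i).
  elim: r => [|a r IH]; first by rewrite !big_nil (is_norm0 N).
  by rewrite !big_cons (le_trans (is_norm_triangle N _ _))// lerD2l.
apply: (le_trans (S _ _)); apply: ler_sum => i _.
by rewrite (is_normZ N) mulrC ler_wpM2l ?is_norm_ge0// mx_normr_entry.
Qed.

Lemma is_norm_continuous (R : realType) (n : nat) (nrm : 'cV[R]_n -> R) :
  is_norm nrm -> continuous nrm.
Proof.
move=> N; have [C C0 nC] := is_norm_upper N.
move=> x; apply: (cvgrPdist_le (F := nbhs x) _ _).2 => e e0; near=> y.
suff : `|nrm x - nrm y| <= C * `|x - y|.
  move=> /le_trans; apply; rewrite mulrC -ler_pdivlMr//; near: y.
  by apply: cvgr_dist_le => //; rewrite divr_gt0.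
have := is_norm_triangle N (x - y) y; have := is_norm_triangle N (y - x) x.
rewrite !subrK; have := nC (x - y); have := nC (y - x).
by rewrite ler_norml (distrC y); lra.
Unshelve. all: by end_near. Qed.

Lemma cV_bounded_closed_compact (R : realType) (n : nat) (A : set 'cV[R]_n) :
  bounded_set A -> closed A -> compact A.
Proof.
move=> bA cA.
have ctr p q : continuous (fun B : 'M[R]_(p, q) => B^T).
  move=> B; apply: (@cvg_mx_entries _ _ _ _ (nbhs B)) => i j; rewrite mxE.
  by under eq_fun do rewrite mxE; exact: coord_continuous.
have ntr p q (B : 'M[R]_(p, q)) : `|B^T| <= `|B|.
  by apply: mx_normr_le => // i j; rewrite mxE mx_normr_entry.
have -> : A = trmx @` [set v : 'rV[R]_n | A v^T].
  apply/seteqP; split=> [x Ax|_ [v /= Av <-]//].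
  by exists x^T; rewrite /= trmxK.
apply: continuous_compact; first by apply: continuous_subspaceT; exact: ctr.
apply: bounded_closed_compact.
  move: bA => [M [Mr AM]]; exists M; split=> // y My v /= Av.
  by rewrite -(trmxK v) (le_trans (ntr _ _ _))//; exact: AM.
by apply: preimage_closed => // v _; exact: ctr.
Qed.

Lemma cV_closed_ball_compact (R : realType) (n : nat) (x : 'cV[R]_n) r :
  compact [set y | `|y - x| <= r].
Proof.
apply: cV_bounded_closed_compact.
  exists (r + `|x|); split; first exact: num_real.
  move=> M rM y /= yx; rewrite -(subrK x y) (le_trans (ler_normD _ _))//.
  by rewrite (le_trans _ (ltW rM))// lerD2r.
have : closed (closed_ball_ Num.Def.normr x r) by exact: closed_closed_ball_.
by congr closed; apply/seteqP; split=> y /=; rewrite distrC.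
Qed.

(** The minimum of the norm on the compact max-norm unit sphere is positive. *)
Lemma is_norm_lower (R : realType) (n : nat) (nrm : 'cV[R]_n -> R) :
  is_norm nrm -> exists2 c, 0 < c & forall x, c * `|x| <= nrm x.
Proof.
move=> N.
have [[x0 x0N0]|all0] := pselect (exists x : 'cV[R]_n, x != 0); last first.
  exists 1 => // x; have [->|xN0] := eqVneq x 0; last by case: all0; exists x.
  by rewrite normr0 mulr0 is_norm_ge0.
pose S := [set x : 'cV[R]_n | `|x| = 1].
have unit x : x != 0 -> S (`|x|^-1 *: x).
  by move=> xN0; rewrite /S /= normrZ normfV normr_id mulVf// normr_eq0.
have cS : compact S.
  apply: cV_bounded_closed_compact.
    by exists 1; split=> // y y1 x /= ->; exact: ltW.
  rewrite (_ : S = Num.norm @^-1` [set 1 : R])//.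
  by apply: preimage_closed => [x _|]; [exact: norm_continuous|exact: closed_eq].
have [c] := compact_EVT_min (ex_intro _ _ (unit _ x0N0)) cS
  (continuous_subspaceT (is_norm_continuous N)).
rewrite inE => Sc cmin; exists (nrm c).
  rewrite lt_neqAle is_norm_ge0// andbT eq_sym; apply/negP => /eqP.
  by move=> /(is_norm_eq0 N) c0; move: Sc; rewrite /S/= c0 normr0; lra.
move=> x; have [->|xN0] := eqVneq x 0.
  by rewrite normr0 mulr0 is_norm_ge0.
have := cmin _ (mem_set (unit _ xN0)); rewrite (is_normZ N) normfV normr_id.
by rewrite ler_pdivlMl ?normr_gt0// mulrC.
Qed.

(** Bouligand tangency, freed of the lower limit, of the infimum and of the
    choice of the norm. *)
Definition subtangent (R : realType) (n : nat) (Omega : set 'cV[R]_n) x z :=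
  forall e delta : R, 0 < e -> 0 < delta -> exists h y,
    [/\ 0 < h, h < delta, Omega y & `|x + h *: z - y| <= e * h].

Lemma tangent_coneP (R : realType) (n : nat) (nrm : 'cV[R]_n -> R)
    (Omega : set 'cV[R]_n) x z :
  is_norm nrm -> Omega !=set0 ->
  tangent_cone nrm Omega x z <-> subtangent Omega x z.
Proof.
move=> N Omega0; rewrite /tangent_cone /= limf_einfE.
set D := fun h => [set nrm (x + h *: z - y) | y in Omega].
set f := fun h : R => (h^-1 * inf (D h))%:E.
have D0 h : D h !=set0.
  by have [y Oy] := Omega0; exists (nrm (x + h *: z - y)), y.
have lbD h : lbound (D h) 0 by move=> _ [y _ <-]; exact: is_norm_ge0.
have infD h : 0 <= inf (D h) by exact: lb_le_inf.
have right0 (r : R) : 0 < r -> 0^'+ [set h | 0 < h < r].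
  move=> r0; near=> h; apply/andP; split=> //; near: h; exact: nbhs_right_lt.
split=> [fE e r e0 r0|tg].
  have [c c0 cN] := is_norm_lower N.
  have inf_le0 : (ereal_inf (f @` [set h | (0 < h < r)%R]) <= 0)%E.
    rewrite -fE; apply: ereal_sup_ubound.
    by exists [set h | 0 < h < r]; first exact: right0.
  have [[h [/andP[h0 hr] fh]]|nh] :=
      pselect (exists h : R, 0 < h < r /\ h^-1 * inf (D h) < c * e); last first.
    have : ((c * e)%:E <= 0%:E)%E.
      apply: le_trans inf_le0; apply: le_ereal_inf_tmp => _ [h hr <-].
      by rewrite lee_fin leNgt; apply/negP => fh; apply: nh; exists h.
    by rewrite lee_fin leNgt mulr_gt0.
  rewrite ltr_pdivrMl// in fh.
  have [_ [y Oy <-] yh] := inf_lt (D0 h) fh.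
  exists h, y; split=> //; rewrite -(ler_pM2l c0) (le_trans (cN _))//.
  by rewrite (le_trans (ltW yh))// mulrCA (mulrC h).
apply/eqP; rewrite eq_le; apply/andP; split.
  apply: ge_ereal_sup => _ [V V0 <-]; apply/lee_addgt0Pr => e e0; rewrite add0e.
  have [C C0 NC] := is_norm_upper N.
  move: V0 => -[r /= r0 rV].
  have [h [y [h0 hr Oy hy]]] := tg (e / C) r (divr_gt0 e0 C0) r0.
  apply: (@le_trans _ _ (f h)).
    apply: ereal_inf_lbound; exists h => //; apply: rV => //=.
    by rewrite /ball_/= sub0r normrN gtr0_norm.
  rewrite lee_fin ler_pdivrMl//.
  apply: (@le_trans _ _ (nrm (x + h *: z - y))).
    by apply: ge_inf; [exists 0; exact: lbD|exists y].
  rewrite (le_trans (NC _))// mulrC -ler_pdivlMr// (le_trans hy)//.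
  by rewrite mulrC mulrA.
apply: ereal_sup_ge; exists (ereal_inf (f @` [set h | 0 < h < 1])).
  by exists [set h | 0 < h < 1] => //; exact: right0.
apply: le_ereal_inf_tmp => _ [h /andP[h0 _] <-].
by rewrite lee_fin mulr_ge0// invr_ge0 ltW.
Unshelve. all: by end_near. Qed.

(** * Subtangency and homogeneity *)

(** The norm along the orbit is continuous, exceeds 1 somewhere because of the
    limit at plus infinity, and is below 1 somewhere because of the limit at
    minus infinity. *)
Lemma dilation_unit_norm (R : realType) (n : nat) (nrm : 'cV[R]_n -> R)
    (d : R -> 'M[R]_n) (x : 'cV[R]_n) :
  is_norm nrm -> is_dilation nrm d -> x != 0 -> exists s, nrm (d s *m x) = 1.
Proof.
move=> N [[G dG] dpinf dninf] xN0.
pose f s := nrm (d s *m x).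
have cf : continuous f.
  have -> : f = nrm \o ((fun B => B *m x) \o (fun s => expmx (s *: G))).
    by apply/funext => s; rewrite /f dG.
  move=> s; apply: continuous_comp; last exact: is_norm_continuous.
  by apply: continuous_comp; [exact: expmx_continuous|exact: mulmxr_continuous].
have [b fb] : exists b, 1 < f b.
  have := dpinf _ xN0; rewrite limf_einfE => dp.
  have : (1%:E < +oo :> \bar R)%E by exact: ltry.
  rewrite -dp => /ereal_sup_gt[_ [V Voo <-] fV].
  have [b Vb] := filter_ex Voo.
  exists b; rewrite -lte_fin (lt_le_trans fV)//.
  by apply: ereal_inf_lbound; exists b.
have [a fa] : exists a, f a < 1.
  have := dninf _ xN0; rewrite limf_esupE => dp.
  have : (0 < 1%:E :> \bar R)%E by rewrite lte_fin.
  rewrite -dp => /ereal_inf_lt[_ [V Voo <-] fV].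
  have [a Va] := filter_ex Voo.
  exists a; rewrite -lte_fin (le_lt_trans _ fV)//.
  by apply: ereal_sup_ubound; exists a.
have [ab|ba] := leP a b.
  have [|c _ fc] := IVT ab (continuous_subspaceT cf) (v := 1); last by exists c.
  by rewrite ge_min le_max (ltW fa) (ltW fb) orbT.
have [|c _ fc] := IVT (ltW ba) (continuous_subspaceT cf) (v := 1);
  last by exists c.
by rewrite ge_min le_max (ltW fa) (ltW fb) orbT.
Qed.

Lemma dilationK (R : realType) (n : nat) (nrm : 'cV[R]_n -> R)
    (d : R -> 'M[R]_n) s :
  is_dilation nrm d -> d (- s) *m d s = 1%:M.
Proof. by move=> [[G dG] _ _]; rewrite !dG -{2}(opprK s) expmxN. Qed.

(** Applying [d (- s)] to [d s x + h g (d s x) - y] turns a step [h] at [d s x]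
    into the step [h exp(mu s)] at [x]; the error grows by a constant factor. *)
Lemma subtangent_pullback (R : realType) (n : nat) (nrm : 'cV[R]_n -> R)
    (d : R -> 'M[R]_n) (Omega : set 'cV[R]_n) (g : 'cV[R]_n -> 'cV[R]_n)
    (mu : R) x s :
  is_dilation nrm d -> homogeneous_cone d Omega -> homogeneous_field d mu g ->
  subtangent Omega (d s *m x) (g (d s *m x)) -> subtangent Omega x (g x).
Proof.
move=> D [_ dO] gd tg e delta e0 delta0.
set k := expR (mu * s); have k0 : 0 < k by exact: expR_gt0.
pose K := n%:R * `|d (- s)| + 1; have K0 : 0 < K by rewrite ltr_wpDl// mulr_ge0.
have [h [y [h0 hd Oy hy]]] := tg (e * k / K) (delta / k)
  (divr_gt0 (mulr_gt0 e0 k0) K0) (divr_gt0 delta0 k0).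
exists (h * k), (d (- s) *m y); split; first exact: mulr_gt0.
- by rewrite -ltr_pdivlMr.
- by apply: dO; exists y.
have -> : x + (h * k) *: g x - d (- s) *m y =
    d (- s) *m (d s *m x + h *: g (d s *m x) - y).
  rewrite gd mulmxBr mulmxDr -!scalemxAr !mulmxA (dilationK s D) !mul1mx.
  by rewrite scalerA.
rewrite (le_trans (mx_normrM _ _))//.
apply: (@le_trans _ _ (K * `|d s *m x + h *: g (d s *m x) - y|)).
  by rewrite ler_wpM2r// lerDl.
by rewrite mulrC -ler_pdivlMr// (le_trans hy)// mulrAC -(mulrA e) (mulrC k).
Qed.

Lemma subtangent_interior (R : realType) (n : nat) (Omega : set 'cV[R]_n) x z :
  Omega° x -> subtangent Omega x z.
Proof.
move=> /nbhs_ballP[r /= r0 rO] e delta e0 delta0.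
pose h := Num.min delta (r / (`|z| + 1)) / 2.
have z0 : 0 < `|z| + 1 by rewrite ltr_wpDl.
have m0 : 0 < Num.min delta (r / (`|z| + 1)) by rewrite lt_min delta0 divr_gt0.
have h0 : 0 < h by rewrite divr_gt0.
have : h < Num.min delta (r / (`|z| + 1)) by rewrite /h; lra.
rewrite lt_min => /andP[hd]; rewrite ltr_pdivlMr// => hr.
exists h, (x + h *: z); split=> //; last by rewrite subrr normr0 mulr_ge0 // ltW.
apply: rO; rewrite -ball_normE /= opprD addrA subrr sub0r normrN normrZ gtr0_norm//.
by rewrite (le_lt_trans _ hr)// ler_wpM2l ?lerDl// ltW.
Qed.

Lemma subtangent_everywhere (R : realType) (n : nat) (nrm : 'cV[R]_n -> R)
    (d : R -> 'M[R]_n) (Omega : set 'cV[R]_n) (g : 'cV[R]_n -> 'cV[R]_n)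
    (mu : R) :
  is_norm nrm -> is_dilation nrm d -> homogeneous_cone d Omega ->
  homogeneous_field d mu g -> g 0 = 0 ->
  (forall x, (boundary Omega `&` unit_sphere nrm) x ->
     tangent_cone nrm Omega x (g x)) ->
  forall x, Omega x -> subtangent Omega x (g x).
Proof.
move=> N D HO gd g0 tg x Ox; have [x0|xN0] := eqVneq x 0.
  rewrite x0 in Ox *; rewrite g0 => e r e0 r0; exists (r / 2), 0.
  by split=> //; rewrite ?scaler0 ?addr0 ?subrr ?normr0 ?mulr_ge0//; lra.
have [s s1] := dilation_unit_norm N D xN0.
apply: (subtangent_pullback (s := s) D HO gd).
have Oy : Omega (d s *m x) by apply: (HO.2 s); exists x.
have [int|nint] := pselect (Omega° (d s *m x)); first exact: subtangent_interior.
apply/(tangent_coneP _ _ N HO.1); apply: tg; split=> //; split=> //.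
exact: subset_closure.
Qed.

(** * Necessity: differentiating an invariant solution *)

Lemma is_derive_entry (R : realType) (m n : nat) (u : R -> 'M[R]_(m, n)) t v i j :
  is_derive t (1 : R) u v -> is_derive t (1 : R) (fun s => u s i j) (v i j).
Proof.
move=> [du <-]; apply: DeriveDef; first exact: (derivable_mxP u t 1).1.
by rewrite derive_mx// mxE.
Qed.

Lemma solution_horizon (R : realType) (n : nat) (g : 'cV[R]_n -> 'cV[R]_n) T u :
  is_solution g T u -> exists2 tau : R, 0 < tau & (tau%:E <= T)%E.
Proof.
case; case: T => [r||] //= r0 _ _; first by exists r.
by exists 1 => //; rewrite leey.
Qed.

(** A solution solves the equation only at positive times; its right derivative
    at 0 comes from the mean value theorem in each coordinate and from the
    continuity of [g] along the solution. *)
Lemma solution_right_derivative (R : realType) (n : nat)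
    (g : 'cV[R]_n -> 'cV[R]_n) T u :
  continuous g -> is_solution g T u -> forall e, 0 < e ->
  exists2 delta, 0 < delta & forall h, 0 < h -> h < delta ->
    `|u h - u 0 - h *: g (u 0)| <= e * h.
Proof.
move=> cg sol e e0; have [tau tau0 tauT] := solution_horizon sol.
case: sol => _ cu du.
have A0 : [set t : R | 0 <= t /\ (t%:E < T)%E] 0.
  by split=> //; rewrite (lt_le_trans _ tauT)// lte_fin.
have cgu : g \o u @ within [set t : R | 0 <= t /\ (t%:E < T)%E] (nbhs 0)
    --> g (u 0).
  apply: cvg_comp; last exact: cg.
  exact: (subspace_continuousP _ _).1 cu _ A0.
have [r /= r0 rg] := (cvgrPdist_le _ _).1 cgu e e0.
exists (Num.min tau r) => [|h h0]; first by rewrite lt_min tau0.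
rewrite lt_min => /andP[htau hr].
have inT (t : R) : t <= h -> (t%:E < T)%E.
  by move=> th; rewrite (lt_le_trans _ tauT)// lte_fin (le_lt_trans th).
apply: mx_normr_le => [|i j]; first by rewrite mulr_ge0// ltW.
have du_in t : t \in `]0, h[%R ->
    is_derive t (1 : R) (fun t => u t i j) (g (u t) i j).
  rewrite in_itv/= => /andP[t0 th].
  by apply: is_derive_entry; apply: du => //; apply: inT; exact: ltW.
have cu_in : {within `[0, h]%classic, continuous (fun t => u t i j)}.
  apply/subspace_continuousP => t /=; rewrite in_itv/= => /andP[t0 th].
  apply: (@cvg_comp _ _ _ u (fun B : 'cV[R]_n => B i j) _ (nbhs (u t)));
    last exact: coord_continuous.
  have /(_ t) := (subspace_continuousP _ _).1 cu.
  move=> /(_ (conj t0 (inT _ th))); apply: cvg_trans.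
  apply: cvg_app; apply: (within_subset (nbhs_filter t)).
  by move=> s /=; rewrite in_itv/= => /andP[s0 sh]; split=> //; exact: inT.
have [c] := MVT h0 du_in cu_in.
rewrite in_itv/= subr0 => /andP[c0 ch] uE.
rewrite !mxE uE [h * _]mulrC -mulrBl normrM (gtr0_norm h0) ler_wpM2r ?(ltW h0)//.
have := rg c; rewrite /= sub0r normrN gtr0_norm// => /(_ (lt_trans ch hr)).
move=> /(_ (conj (ltW c0) (inT _ (ltW ch)))) le_e. apply: le_trans le_e.
by have := mx_normr_entry (g (u 0) - g (u c)) i j; rewrite !mxE distrC.
Qed.

(** The solution issued from [x] is a curve in [Omega] with velocity [g x] at
    time 0. *)
Lemma invariant_subtangent (R : realType) (n : nat)
    (g : 'cV[R]_n -> 'cV[R]_n) (Omega : set 'cV[R]_n) :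
  continuous g -> forward_complete_on g Omega -> positively_invariant g Omega ->
  forall x, Omega x -> subtangent Omega x (g x).
Proof.
move=> cg comp inv x Ox e r e0 r0; have [u [sol u0]] := comp x Ox.
have [delta delta0 dU] := solution_right_derivative cg sol e0.
pose h := Num.min r delta / 2.
have m0 : 0 < Num.min r delta by rewrite lt_min r0.
have h0 : 0 < h by rewrite /h; lra.
have : h < Num.min r delta by rewrite /h; lra.
rewrite lt_min => /andP[hr hd].
exists h, (u h); split=> //.
  by apply: (inv _ _ sol 0 (lexx _)) => //; rewrite ?u0 ?ltry.
by rewrite distrC opprD addrA -u0; exact: dU.
Qed.

(** * Euler polygons in the constraint set *)

(** A step length that works at [x] works at all nearby points, with twice the
    error.  Compactness then gives a common lower bound of the step lengths,
    without which the nodes of an Euler polygon could accumulate. *)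
Lemma uniform_step (R : realType) (n : nat) (g : 'cV[R]_n -> 'cV[R]_n)
    (Omega K : set 'cV[R]_n) (e : R) :
  continuous g -> compact K -> (forall x, K x -> subtangent Omega x (g x)) ->
  0 < e ->
  exists2 rho, 0 < rho & forall x, K x -> exists h y,
    [/\ rho <= h, h < e, Omega y & `|x + h *: g x - y| <= e * h].
Proof.
move=> cg /compact_near_coveringP cK tg e0.
pose P rho x := exists h y,
    [/\ rho <= h, h < e, Omega y & `|x + h *: g x - y| <= e * h].
have : \forall rho \near (0 : R)^'+, K `<=` P rho.
  apply: cK => x Kx.
  (* half of the accuracy is left for the continuity in the base point *)
  have e2 : 0 < e / 2 by rewrite divr_gt0.
  have [h [y [h0 he Oy hy]]] := tg x Kx _ _ e2 e0.
  have cf : `|x' + h *: g x' - y| @[x' --> x] --> `|x + h *: g x - y|.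
    apply: (@cvg_norm _ _ _ (nbhs x)); apply: (@cvgB _ _ _ (nbhs x)).
      apply: (@cvgD _ _ _ (nbhs x)); first exact: cvg_id.
      by apply: (@cvgZ _ _ _ (nbhs x)); [exact: cvg_cst|exact: cg].
    exact: cvg_cst.
  have eh : `|x + h *: g x - y| < e * h by rewrite (le_lt_trans hy)// ltr_pM2r//; lra.
  exists ([set x' | `|x' + h *: g x' - y| <= e * h], [set rho | rho <= h]).
    split=> /=; last exact: nbhs_right_le.
    exact: (cvgr_le _ cf _ eh).
  by move=> [x' rho] /= [x'y rhoh]; exists h, y.
move=> nearP; near (0 : R)^'+ => rho; exists rho => //.
have : K `<=` P rho by near: rho.
exact.
Unshelve. all: by end_near. Qed.

(** Inexact Euler steps whose error is corrected so as to land in [Omega]; [t k]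
    and [x k] are the date and the position of the [k]-th node. *)
Lemma euler_sequence (R : realType) (n : nat) (G : 'cV[R]_n -> 'cV[R]_n)
    (Omega : set 'cV[R]_n) (rho e : R) (x0 : 'cV[R]_n) :
  (forall x, Omega x -> exists h y,
    [/\ rho <= h, h <= e, Omega y & `|x + h *: G x - y| <= e * h]) ->
  Omega x0 ->
  exists (t : nat -> R) (x : nat -> 'cV[R]_n),
  [/\ t 0%N = 0 /\ x 0%N = x0,
      forall k, Omega (x k),
      forall k, rho <= t k.+1 - t k <= e
    & forall k, `|x k + (t k.+1 - t k) *: G (x k) - x k.+1|
                <= e * (t k.+1 - t k)].
Proof.
move=> step Ox0.
have /choice[next nextP] : forall x, exists p : R * 'cV[R]_n, Omega x ->
    [/\ rho <= p.1, p.1 <= e, Omega p.2 & `|x + p.1 *: G x - p.2| <= e * p.1].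
  move=> x; have [/step[h [y hy]]|nOx] := pselect (Omega x); first by exists (h, y).
  by exists (0, x).
pose x k := iter k (fun x => (next x).2) x0.
pose t k := \sum_(0 <= j < k) (next (x j)).1.
have Ox k : Omega (x k).
  by elim: k => [//|k IH]; have [] := nextP _ IH.
have dt k : t k.+1 - t k = (next (x k)).1.
  by rewrite /t big_nat_recr//= addrAC subrr add0r.
exists t, x; split=> //.
- by rewrite /t big_geq.
- by move=> k; rewrite dt; have [-> ->] := nextP _ (Ox k).
- by move=> k; rewrite dt; have [] := nextP _ (Ox k).
Qed.

(** While the slopes stay within [eta] of [z], each step deviates from the
    motion of velocity [z] at rate at most [eta], plus [e] for the correction.
    The case [z = 0] bounds the displacement. *)
Lemma euler_sequence_drift (R : realType) (n : nat) (G : 'cV[R]_n -> 'cV[R]_n)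
    (e eta : R) (t : nat -> R) (x : nat -> 'cV[R]_n) z i j :
  (forall k, t k <= t k.+1) ->
  (forall k, `|x k + (t k.+1 - t k) *: G (x k) - x k.+1|
     <= e * (t k.+1 - t k)) ->
  (i <= j)%N ->
  (forall k, (i <= k < j)%N -> `|G (x k) - z| <= eta) ->
  `|x j - x i - (t j - t i) *: z| <= (eta + e) * (t j - t i).
Proof.
move=> tS xS /subnK <-; elim: (j - i)%N => [|m IH] Gz.
  by rewrite !add0n !subrr scale0r subr0 normr0 mulr0.
rewrite addSn; set k := (m + i)%N in IH *.
have -> : x k.+1 - x i - (t k.+1 - t i) *: z =
    (x k - x i - (t k - t i) *: z) - (x k + (t k.+1 - t k) *: G (x k) - x k.+1)
    + (t k.+1 - t k) *: (G (x k) - z).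
  apply/matrixP => a b; rewrite !mxE; ring.
have dt0 : 0 <= t k.+1 - t k by rewrite subr_ge0.
rewrite (le_trans (ler_normD _ _))// normrZ (ger0_norm dt0).
rewrite (le_trans (lerD (ler_normB _ _) (lexx _)))//.
have {IH}IHk : `|x k - x i - (t k - t i) *: z| <= (eta + e) * (t k - t i).
  apply: IH => l /andP[il lk]; apply: Gz; rewrite il/=.
  by rewrite addSn ltnS ltnW.
have Gk : `|G (x k) - z| <= eta by apply: Gz; rewrite addSn ltnS leqnn leq_addl.
have := ler_wpM2l dt0 Gk; have := xS k; lra.
Qed.

(** [idx s] is the last node dated at most [s]; the dates tend to infinity since
    the steps are bounded below by [rho]. *)
Lemma euler_node_index (R : realType) (rho e : R) (t : nat -> R) :
  0 < rho -> t 0%N = 0 -> (forall k, rho <= t k.+1 - t k <= e) ->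
  exists idx : R -> nat,
    (forall s, 0 <= s -> t (idx s) <= s /\ s - e < t (idx s)) /\
    (forall a b, 0 <= a -> a <= b -> (idx a <= idx b)%N) /\ idx 0 = 0%N.
Proof.
move=> rho0 t0 dt.
have tge k : rho *+ k <= t k.
  elim: k => [|k IH]; first by rewrite mulr0n t0.
  by have /andP[+ _] := dt k; rewrite mulrSr; lra.
have ex s : exists k, s < t k.+1.
  have [k sk] : exists k : nat, s / rho < k%:R.
    exists (Num.bound `|s / rho|).
    exact: le_lt_trans (ler_norm _) (archi_boundP (normr_ge0 _)).
  exists k; rewrite (lt_le_trans _ (tge _))// mulrSr.
  by rewrite ltr_pdivrMr// mulr_natl in sk; rewrite ltr_wpDr// ltW.
exists (fun s => ex_minn (ex s)); split; last split.
- move=> s s0; case: ex_minnP => k sk kmin.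
  split; last by have /andP[_] := dt k; lra.
  case: k => [|k] in sk kmin *; first by rewrite t0.
  by rewrite leNgt; apply/negP => /kmin; rewrite ltnn.
- move=> a b a0 ab; case: ex_minnP => k ak kmin; case: ex_minnP => l bl _.
  by apply: kmin; exact: le_lt_trans bl.
- case: ex_minnP => k _ kmin; apply/eqP; rewrite -leqn0; apply: kmin.
  by have /andP[+ _] := dt 0%N; rewrite t0; lra.
Qed.

(** The piecewise constant interpolation of an Euler sequence: it is not
    continuous, but it stays in [Omega], and rounding a time to a node costs at
    most [e].  The hypothesis on [z] asks the field to be close to [z] on a ball
    around [w a] that the polygon cannot leave before time [b]. *)
Lemma approximate_solution (R : realType) (n : nat) (G : 'cV[R]_n -> 'cV[R]_n)
    (Omega : set 'cV[R]_n) (rho e M : R) (x0 : 'cV[R]_n) :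
  0 < rho -> 0 <= M ->
  (forall x, `|G x| <= M) ->
  (forall x, Omega x -> exists h y,
    [/\ rho <= h, h <= e, Omega y & `|x + h *: G x - y| <= e * h]) ->
  Omega x0 ->
  exists w : R -> 'cV[R]_n, [/\ w 0 = x0, forall s, Omega (w s) &
    forall a b z eta, 0 <= a -> a <= b -> 0 <= eta ->
      (forall x, Omega x -> `|x - w a| <= (M + e) * (b - a + e) ->
         `|G x - z| <= eta) ->
      `|w b - w a - (b - a) *: z| <= (eta + e) * (b - a + e) + `|z| * e].
Proof.
move=> rho0 M0 GM step Ox0.
have [t [x [[t0 xx0] Ox dt xS]]] := euler_sequence step Ox0.
have [idx [idxP [idxle idx0]]] := euler_node_index rho0 t0 dt.
have e0 : 0 < e by have /andP[? ?] := dt 0%N; lra.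
have tS k : t k <= t k.+1 by have /andP[? _] := dt k; lra.
have tle i j : (i <= j)%N -> t i <= t j.
  by move=> /subnK <-; elim: (j - i)%N => // m IH; rewrite (le_trans IH)// addSn.
exists (fun s => x (idx s)); split=> //; first by rewrite idx0.
move=> a b z eta a0 ab eta0 Gz.
have [ta1 ta2] := idxP _ a0; have [tb1 tb2] := idxP _ (le_trans a0 ab).
have ij := idxle _ _ a0 ab.
set i := idx a in ta1 ta2 ij Gz *; set j := idx b in tb1 tb2 ij *.
have tij := tle _ _ ij.
have near_xi k : (i <= k < j)%N -> `|G (x k) - z| <= eta.
  move=> /andP[ik kj]; apply: Gz => //.
  have GM' l : (i <= l < k)%N -> `|G (x l) - 0| <= M by rewrite subr0.
  have := euler_sequence_drift tS xS ik GM'.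
  rewrite scaler0 subr0 => /le_trans; apply; apply: ler_wpM2l; first lra.
  by have := tle _ _ (ltnW kj); lra.
have -> : x j - x i - (b - a) *: z =
    (x j - x i - (t j - t i) *: z) + ((t j - t i) - (b - a)) *: z.
  by apply/matrixP => p q; rewrite !mxE; ring.
rewrite (le_trans (ler_normD _ _))// lerD//.
  rewrite (le_trans (euler_sequence_drift tS xS ij near_xi))//.
  by apply: ler_wpM2l; lra.
rewrite normrZ mulrC ler_wpM2l// ler_norml; lra.
Qed.

(** * Limits of Euler polygons *)

Lemma ultra_fmap (T U : Type) (f : T -> U) (F : set_system T) :
  UltraFilter F -> UltraFilter (f @ F).
Proof.
move=> FU; split; first exact: fmap_proper_filter.
move=> H PH FH; apply/seteqP; split=> // A HA.
have [//|FnA] := in_ultra_setVsetC (f @^-1` A) FU.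
have /filter_ex[y [Ay nAy]] : H (A `&` ~` A) by apply: filterI => //; exact: FH.
by case: nAy.
Qed.

Lemma is_derive_little_o (R : realType) (n : nat) (u : R -> 'cV[R]_n) s v :
  (forall eta, 0 < eta -> exists2 delta, 0 < delta & forall h, `|h| < delta ->
     `|u (h + s) - u s - h *: v| <= eta * `|h|) ->
  is_derive s (1 : R) u v.
Proof.
move=> uv.
have H : h^-1 *: (u (h *: (1 : R) + s) - u s) @[h --> (0 : R)^'] --> v.
  apply/cvgrPdist_le => e e0; have [r r0 ur] := uv _ e0.
  near=> h.
  have hN0 : h != 0 by near: h; exact: nbhs_dnbhs_neq.
  have hr : `|h| < r by near: h; exact: dnbhs0_lt.
  rewrite [h *: 1]mulr1.
  have -> : v - h^-1 *: (u (h + s) - u s) = - h^-1 *: (u (h + s) - u s - h *: v).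
    by rewrite [in RHS]scalerBr scalerA mulNr mulVf// scaleN1r opprK addrC scaleNr.
  rewrite normrZ normrN normfV ler_pdivrMl ?normr_gt0// mulrC.
  exact: ur.
have D : derivable u s 1 by apply/cvg_ex; exists v.
apply: DeriveDef => //; exact: cvg_lim H.
Unshelve. all: by end_near. Qed.

(** Along an ultrafilter of accuracies tending to 0, every time [s] gives a
    convergent family of positions, since these stay in a compact ball whose
    radius depends only on [s].  The drift estimates survive pointwise limits,
    and lose their error terms there; with [z] the value of a continuous [G]
    at [u a], the resulting one differentiates the limit at [a]. *)
Lemma approximate_solutions_limit (R : realType) (n : nat)
    (G : 'cV[R]_n -> 'cV[R]_n) (Omega : set 'cV[R]_n) (M : R) (x0 : 'cV[R]_n) :
  closed Omega -> 0 <= M -> (forall x, `|G x| <= M) ->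
  (forall e, 0 < e -> exists2 rho, 0 < rho & forall x, Omega x -> exists h y,
    [/\ rho <= h, h <= e, Omega y & `|x + h *: G x - y| <= e * h]) ->
  Omega x0 ->
  exists u : R -> 'cV[R]_n, [/\ u 0 = x0, forall s, 0 <= s -> Omega (u s) &
    forall a b z eta r, 0 <= a -> a <= b -> 0 <= eta -> M * (b - a) < r ->
      (forall x, Omega x -> `|x - u a| <= r -> `|G x - z| <= eta) ->
      `|u b - u a - (b - a) *: z| <= eta * (b - a)].
Proof.
move=> cO M0 GM step Ox0.
have /choice[w wP] : forall e : R, exists w : R -> 'cV[R]_n, 0 < e ->
    [/\ w 0 = x0, forall s, Omega (w s) &
    forall a b z eta, 0 <= a -> a <= b -> 0 <= eta ->
      (forall x, Omega x -> `|x - w a| <= (M + e) * (b - a + e) ->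
         `|G x - z| <= eta) ->
      `|w b - w a - (b - a) *: z| <= (eta + e) * (b - a + e) + `|z| * e].
  move=> e; have [e0|_] := ltP 0 e; last by exists (fun=> x0).
  have [rho rho0 rhoP] := step _ e0.
  by have [w [? ? ?]] := approximate_solution rho0 M0 GM rhoP Ox0; exists w.
have [U [UU subU]] := ultraFilterLemma (at_right_proper_filter (0 : R)).
have PU : ProperFilter U by exact: ultra_proper.
have Upos : \forall e \near U, 0 < e by apply: subU; exact: nbhs_right_gt.
have Ult (r : R) : 0 < r -> \forall e \near U, e < r.
  by move=> r0; apply: subU; exact: nbhs_right_lt.
have wlip e a b : 0 < e -> 0 <= a -> a <= b ->
    `|w e b - w e a| <= (M + e) * (b - a + e).
  move=> e0 a0 ab; have [_ _ /(_ a b 0 M a0 ab M0)] := wP _ e0.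
  rewrite scaler0 normr0 mul0r subr0 addr0; apply=> x _ _.
  by rewrite subr0.
have /choice[u uP] : forall s : R, exists us : 'cV[R]_n,
    0 <= s -> w e s @[e --> U] --> us.
  move=> s; have [s0|_] := leP 0 s; last by exists 0.
  (* the constants bound (M + e) (s + e) for every accuracy e < 1 *)
  have inball : \forall e \near U, `|w e s - x0| <= (M + 1) * (s + 1).
    near=> e.
    have e0 : 0 < e by near: e.
    have e1 : e < 1 by near: e; exact: Ult.
    have := wlip _ _ _ e0 (lexx 0) s0; have [-> _ _] := wP _ e0.
    move=> /le_trans; apply; rewrite subr0 ler_pM//; lra.
  have := @cV_closed_ball_compact _ _ x0 ((M + 1) * (s + 1)).
  rewrite compact_ultra => /(_ _ (ultra_fmap (fun e => w e s) UU) inball).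
  by move=> [us [_ ?]]; exists us.
have u0 : u 0 = x0.
  have w0 : w e 0 @[e --> U] --> x0.
    apply: cvg_near_cst; near=> e.
    have e0 : 0 < e by near: e.
    by have [-> _ _] := wP _ e0.
  by rewrite -(cvg_lim _ (uP 0 (lexx _)))// (cvg_lim _ w0).
exists u; split=> // [s s0|].
  apply: (@closed_cvg _ _ U PU (fun e => w e s) Omega cO _ (u s) (uP s s0)); near=> e.
  have e0 : 0 < e by near: e.
  by have [] := wP _ e0.
move=> a b z eta r a0 ab eta0 Mr Gz.
have Ueps : e @[e --> U] --> (0 : R).
  by move=> V V0; apply: subU; exact: cvg_within V0.
have U1 : (M + e) * (b - a + e) + `|w e a - u a| @[e --> U] -->
    (M + 0) * (b - a + 0) + `|u a - u a|.
  apply: cvgD.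
    by apply: cvgM; (apply: cvgD; [exact: cvg_cst|exact: Ueps]).
  by apply: cvg_norm; apply: cvgB; [exact: uP|exact: cvg_cst].
have U2 : (eta + e) * (b - a + e) + `|z| * e @[e --> U] -->
    (eta + 0) * (b - a + 0) + `|z| * 0.
  apply: cvgD.
    by apply: cvgM; (apply: cvgD; [exact: cvg_cst|exact: Ueps]).
  by apply: cvgM; [exact: cvg_cst|exact: Ueps].
have U3 : `|w e b - w e a - (b - a) *: z| @[e --> U] -->
    `|u b - u a - (b - a) *: z|.
  apply: cvg_norm; apply: cvgB; last exact: cvg_cst.
  by apply: cvgB; apply: uP => //; exact: le_trans ab.
have -> : eta * (b - a) = (eta + 0) * (b - a + 0) + `|z| * 0 by ring.
apply: (ler_cvg_to U3 U2); near=> e.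
have e0 : 0 < e by near: e.
have [_ _] := wP _ e0; apply=> // x Ox xw; apply: Gz => //.
have -> : x - u a = (x - w e a) + (w e a - u a) by rewrite addrA subrK.
rewrite (le_trans (ler_normD _ _))// (le_trans (lerD xw (lexx _)))//.
near: e; apply: (cvgr_le _ U1).
by rewrite subrr normr0 !addr0.
Unshelve. all: by end_near. Qed.

(** * Viability and invariance *)

(** The limit of the Euler polygons of [g] solves the equation as long as it
    stays in the unit ball around [x0], at least up to time [1 / M] where [M]
    bounds [g] on this ball. *)
Lemma local_viability (R : realType) (n : nat) (g : 'cV[R]_n -> 'cV[R]_n)
    (Omega : set 'cV[R]_n) (x0 : 'cV[R]_n) :
  closed Omega -> continuous g -> (forall x, Omega x -> subtangent Omega x (g x)) ->
  Omega x0 ->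
  exists tau : R, exists u : R -> 'cV[R]_n,
    [/\ 0 < tau, is_solution g tau%:E u, u 0 = x0 &
        forall s, 0 <= s -> Omega (u s)].
Proof.
move=> cO cg tg Ox0.
pose B := [set x : 'cV[R]_n | `|x - x0| <= 1].
have cB : compact B := @cV_closed_ball_compact _ _ x0 1.
have [M M0 gM] : exists2 M, 0 < M & forall x, B x -> `|g x| <= M.
  have [M [_ MP]] : bounded_set (g @` B).
    by apply/compact_bounded/continuous_compact/cB/continuous_subspaceT.
  exists (`|M| + 1) => [|x Bx]; first by rewrite ltr_wpDl.
  by apply: (MP (`|M| + 1)); [rewrite (le_lt_trans (ler_norm _))// ltrDl|exists x].
(* Cutting [g] off outside the ball makes the field bounded everywhere and lets
   polygons that have left the ball stand still; no step can then fail. *)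
pose G x := if `|x - x0| <= 1 then g x else 0.
have GM x : `|G x| <= M.
  by rewrite /G; case: ifPn => [/gM//|_]; rewrite normr0 ltW.
have step e : 0 < e -> exists2 rho, 0 < rho & forall x, Omega x -> exists h y,
    [/\ rho <= h, h <= e, Omega y & `|x + h *: G x - y| <= e * h].
  move=> e0; have cK : compact (B `&` Omega) by exact: compact_closedI.
  have [rho rho0 rhoP] := uniform_step cg cK (fun x Kx => tg x Kx.2) e0.
  exists (Num.min rho e); first by rewrite lt_min rho0.
  move=> x Ox; rewrite /G; case: ifPn => Bx.
    have [h [y [rh he Oy hy]]] := rhoP x (conj Bx Ox).
    by exists h, y; split=> //; [rewrite ge_min rh|exact: ltW].
  exists e, x; split=> //; first by rewrite ge_min lexx orbT.
  by rewrite scaler0 addr0 subrr normr0 mulr_ge0// ltW.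
have [u [u0 uO uP]] := approximate_solutions_limit cO (ltW M0) GM step Ox0.
have ulip a b : 0 <= a -> a <= b -> `|u b - u a| <= M * (b - a).
  move=> a0 ab.
  have := uP a b 0 M (M * (b - a) + 1) a0 ab (ltW M0).
  rewrite ltrDl ltr01 scaler0 subr0 => /(_ isT); apply=> x _ _.
  by rewrite subr0.
have ulip2 a b : 0 <= a -> 0 <= b -> `|u b - u a| <= M * `|b - a|.
  move=> a0 b0; have [ab|/ltW ba] := leP a b.
    by rewrite (ger0_norm (x := b - a)) ?subr_ge0// ulip.
  by rewrite distrC (distrC b) (ger0_norm (x := a - b)) ?subr_ge0// ulip.
have udiff s eta : 0 <= s -> s < M^-1 -> 0 < eta ->
    exists2 delta, 0 < delta & forall t, 0 <= t -> `|t - s| < delta ->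
    `|u t - u s - (t - s) *: g (u s)| <= eta * `|t - s|.
  move=> s0 sM eta0.
  have us1 : `|u s - x0| < 1.
    rewrite -u0 (le_lt_trans (ulip _ _ (lexx _) s0))// subr0.
    by rewrite -(mulfV (lt0r_neq0 M0)) ltr_pM2l.
  have : \forall x \near u s, `|g (u s) - g x| <= eta.
    exact: (cvgrPdist_le (F := nbhs (u s)) _ _).1 (cg (u s)) eta eta0.
  move=> /nbhs_ballP[r1 /= r10 r1P].
  (* Points within [r] of [u a] must be within [2 r] of [u s] when [a] is close
     to [s], and still lie in the unit ball around [x0]. *)
  pose r := Num.min r1 (1 - `|u s - x0|) / 3.
  have m0 : 0 < Num.min r1 (1 - `|u s - x0|) by rewrite lt_min r10 subr_gt0.
  have r0 : 0 < r by rewrite divr_gt0.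
  have : 2 * r < Num.min r1 (1 - `|u s - x0|) by rewrite /r; lra.
  rewrite lt_min => /andP[rr1 rB].
  have Gg x : `|x - u s| <= 2 * r -> `|G x - g (u s)| <= eta.
    move=> xr; rewrite /G ifT.
      by rewrite distrC; apply: r1P; rewrite -ball_normE /= distrC (le_lt_trans xr).
    rewrite -(subrKA (u s)) (le_trans (ler_normD _ _))//; lra.
  exists (r / M) => [|t t0 tsr]; first exact: divr_gt0.
  have Mr : M * `|t - s| < r by rewrite mulrC -ltr_pdivlMr.
  have [st|/ltW ts] := leP s t.
    have ts0 : 0 <= t - s by rewrite subr_ge0.
    rewrite (ger0_norm ts0) in Mr *.
    apply: (uP s t (g (u s)) eta r) => // [|x _ xr]; first exact: ltW.
    by apply: Gg; lra.
  rewrite distrC in Mr; rewrite distrC [ `|t - s|]distrC.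
  have st0 : 0 <= s - t by rewrite subr_ge0.
  rewrite (ger0_norm st0) in Mr *.
  have -> : (t - s) *: g (u s) - (u t - u s) = u s - u t - (s - t) *: g (u s).
    by apply/matrixP => i j; rewrite !mxE; ring.
  apply: (uP t s (g (u s)) eta r) => // [|x _ xr]; first exact: ltW.
  apply: Gg; rewrite -(subrKA (u t)) (le_trans (ler_normD _ _))//.
  by have := ulip t s t0 ts; rewrite distrC; lra.
exists M^-1, u; split=> //; first by rewrite invr_gt0.
split; first by rewrite lte_fin invr_gt0.
- apply/subspace_continuousP => s [s0 _].
  apply/cvgrPdist_le => e e0; near=> t.
  have [t0 _] : 0 <= t /\ (t%:E < (M^-1)%:E)%E by near: t; exact: withinT.
  rewrite distrC (le_trans (ulip2 _ _ s0 t0))// mulrC -ler_pdivlMr// distrC.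
  near: t; apply: cvg_within.
  exact: (@cvgr_dist_le _ _ _ (nbhs s) _ id s cvg_id _ (divr_gt0 e0 M0)).
- move=> s s0; rewrite lte_fin => sM.
  apply: is_derive_little_o => eta eta0.
  have [delta delta0 dP] := udiff s eta (ltW s0) sM eta0.
  exists (Num.min delta s) => [|h]; first by rewrite lt_min delta0.
  rewrite lt_min => /andP[hd hs].
  have hs0 : 0 <= h + s by move: hs; rewrite ltr_norml => /andP[]; lra.
  by have := dP _ hs0; rewrite addrK; exact.
Unshelve. all: by end_near. Qed.

Lemma solution_shift (R : realType) (n : nat) (g : 'cV[R]_n -> 'cV[R]_n)
    (T : \bar R) (tau c : R) u :
  is_solution g T u -> 0 <= c -> 0 < tau -> ((c + tau)%:E <= T)%E ->
  is_solution g tau%:E (fun s => u (s + c)).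
Proof.
move=> [_ cu du] c0 tau0 cT.
have inT (s : R) : s < tau -> ((s + c)%:E < T)%E.
  by move=> st; rewrite (lt_le_trans _ cT)// lte_fin addrC ltrD2l.
split; first by rewrite lte_fin.
- apply/subspace_continuousP => s [s0 /=]; rewrite lte_fin => st.
  have Asc : [set t : R | 0 <= t /\ (t%:E < T)%E] (s + c).
    by split; [exact: addr_ge0|exact: inT].
  move=> V /((subspace_continuousP _ _).1 cu _ Asc) sV.
  have shc : t + c @[t --> s] --> s + c.
    by apply: cvgD; [exact: cvg_id|exact: cvg_cst].
  apply: (@filterS _ (nbhs s) _ _ _ _ (shc _ sV)) => t tV [/= t0].
  rewrite lte_fin => tt.
  by apply: tV; split; [exact: addr_ge0|exact: inT].
- move=> s s0; rewrite lte_fin => st.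
  have [D <-] := du (s + c) (ltr_wpDr c0 s0) (inT _ st).
  have E : (fun h : R =>
      h^-1 *: (((fun s => u (s + c)) \o shift s) (h *: 1) - u (s + c))) =
    (fun h : R => h^-1 *: ((u \o shift (s + c)) (h *: 1) - u (s + c))).
    by apply/funext => h /=; rewrite addrA.
  by apply: DeriveDef; rewrite /derivable /derive E.
Qed.

Theorem corollary4p2 (R : realType) (n : nat) (nrm : 'cV[R]_n -> R)
    (d : R -> 'M[R]_n) (Omega : set 'cV[R]_n)
    (g : 'cV[R]_n -> 'cV[R]_n) (mu : R) :
  is_norm nrm ->
  is_dilation nrm d ->
  monotone_dilation nrm d ->
  closed Omega ->
  homogeneous_cone d Omega ->
  continuous g ->
  homogeneous_field d mu g ->
  g 0 = 0 ->
  forward_unique_on g Omega ->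
  forward_complete_on g Omega ->
  (positively_invariant g Omega <->
   (forall x : 'cV[R]_n, (boundary Omega `&` unit_sphere nrm) x ->
      tangent_cone nrm Omega x (g x))).
Proof.
move=> N D _ cO HO cg gd g0 uniq comp; split=> [inv x [[clx _] _]|tg].
  apply/(tangent_coneP _ _ N HO.1); apply: invariant_subtangent => //.
  by rewrite (closure_id Omega).1.
have {}tg := subtangent_everywhere N D HO gd g0 tg.
move=> T u sol t' t'0 t'T Ot' t t't tT.
apply: contrapT => nOt.
(* [c] is the last time in [t', t] at which the solution is in [Omega]. *)
pose S := [set s | t' <= s <= t /\ Omega (u s)].
have St' : S t' by split=> //; rewrite lexx ltW.
have supS : has_sup S by split; [exists t'|exists t => s [/andP[]]].
pose c := sup S.
have t'c : t' <= c by exact: ub_le_sup supS.2 _ St'.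
have ct : c <= t by apply: ge_sup; [exists t'|move=> s [/andP[]]].
have Oc : Omega (u c).
  have [ct'|ct'] := eqVneq c t'; first by rewrite ct'.
  have c0 : 0 < c by rewrite (le_lt_trans t'0)// lt_neqAle eq_sym ct'.
  have cu : {for c, continuous u}.
    apply: differentiable_continuous; apply/derivable1_diffP.
    case: sol => _ _ du.
    have cT : (c%:E < T)%E by rewrite (le_lt_trans _ tT)// lee_fin.
    exact: (@ex_derive _ _ _ _ _ _ _ (du c c0 cT)).
  apply: cO => V Vc; have [r /= r0 rV] := cu V Vc.
  have [s Ss cs] := sup_adherent r0 supS.
  exists (u s); split; first by case: Ss.
  apply: rV; rewrite /ball/= ger0_norm ?subr_ge0; first by rewrite ltrBlDr -ltrBlDl.
  exact: ub_le_sup supS.2 _ Ss.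
have cltt : c < t.
  by rewrite lt_neqAle ct andbT; apply/negP => /eqP ce; apply: nOt; rewrite -ce.
have [tau [v [tau0 vsol v0 vO]]] := local_viability cO cg tg Oc.
(* Both solutions from [u c] exist on [0, T1[, and [c + T1 / 2] lies between [c]
   and [t]. *)
pose T1 := Num.min tau (t - c).
have T10 : 0 < T1 by rewrite lt_min tau0 subr_gt0.
have c0 : 0 <= c by exact: le_trans t'c.
have T1T : ((c + T1)%:E <= T)%E.
  by rewrite (le_trans _ (ltW tT))// lee_fin -lerBrDl ge_min lexx orbT.
have usol := solution_shift sol c0 T10 T1T.
have vsol1 : is_solution g T1%:E v.
  have := solution_shift vsol (lexx 0) T10; rewrite add0r lee_fin ge_min lexx.
  by move=> /(_ isT); under eq_fun do rewrite addr0.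
have := uniq _ Oc _ _ _ usol _ vsol1 v0 (T1 / 2).
rewrite add0r => /(_ erefl) uv.
have T1h : T1 / 2 < T1 by lra.
have Ov : Omega (u (T1 / 2 + c)) by rewrite uv ?lte_fin//; [apply: vO|]; lra.
have T1t : T1 <= t - c by rewrite ge_min lexx orbT.
have : T1 / 2 + c <= c.
  apply: ub_le_sup supS.2 _ _; split=> //; apply/andP; split; lra.
lra.
Qed.
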